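(* Let $V$ be a finite set and let $\mathcal{B}\subseteq V^3$ be a ternary relation on $V$ (write $abc$ for $(a,b,c)$) satisfying: (B) for all pairwise distinct $a,b,c\in V$, $\mathcal{B}$ contains at least one of $abc,acb,bac,bca,cab,cba$; (C) for all $a,b,c\in V$, $abc\in\mathcal{B}$ implies $acb\notin\mathcal{B}$; (D) for all $a,b,c\in V$, $abc\in\mathcal{B}$ implies $a,b,c$ are pairwise distinct; (F) for all $a,b,c\in V$, $abc\in\mathcal{B}$ implies $bca\in\mathcal{B}$ or $cba\in\mathcal{B}$; (2) for all $a,b,c,x\in V$, $abc\in\mathcal{B}$ and $bxc\in\mathcal{B}$ imply $abx\in\mathcal{B}$. If $\mathcal{B}$ does not satisfy axiom (A) (for all $a,b,c\in V$, $abc\in\mathcal{B}$ implies $cba\in\mathcal{B}$), then there is an integer $p\le |V|$ and a strongly connected subdigraph $D$ of $D_{p,p}$ such that $\mathcal{B}$ is isomorphic to $\mathcal{B}_d$, where $d$ is the shortest-path quasimetric of $D$. If $\mathcal{B}$ satisfies axiom (A), then $\mathcal{B}$ is isomorphic to $\mathcal{B}_d$ where $d$ is the shortest-path metric of an undirected path on $|V|$ vertices or of an undirected cycle of length four.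
   Context: A ternary relation on a set $V$ is a subset $\mathcal{B}\subseteq V^3$. Two ternary relations $\mathcal{B}\subseteq V^3$ and $\mathcal{B}'\subseteq W^3$ are isomorphic if there is a bijection $f:V\to W$ with $abc\in\mathcal{B}\iff f(a)f(b)f(c)\in\mathcal{B}'$. For a (quasi)metric $d$ on a set $W$ (a function $W\times W\to\mathbb{R}_{\ge0}$ with $d(x,y)=0\iff x=y$ and the triangle inequality, symmetry not required), $\mathcal{B}_d$ is the set of triples $abc$ of pairwise distinct points of $W$ with $d(a,c)=d(a,b)+d(b,c)$. The shortest-path (quasi)metric of a strongly connected digraph (resp. connected graph) assigns to $(x,y)$ the length of a shortest directed path (resp. path) from $x$ to $y$. For an integer $p\ge1$, $D_{p,p}$ is the digraph with vertex set $\{v_0,u_0,v_1,u_1,\dots,v_{p-1},u_{p-1}\}$ and arc set $\{v_iv_j,\,v_iu_j,\,u_iv_j,\,u_iu_j : i,j\in\mathbb{Z}_p,\ j\equiv i+1 \pmod p\}$ (obtained from a directed $p$-cycle by duplicating every vertex). *)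

(* Defs.v *)
(* MathComp *)
From mathcomp Require Import all_boot.

Set Implicit Arguments.
Unset Strict Implicit.
Unset Printing Implicit Defensive.

Definition ternary_relation (V : finType) := {set V * V * V}.

Definition isomorphic (V W : finType)
    (B : ternary_relation V) (B' : ternary_relation W) : Prop :=
  exists2 f : V -> W, bijective f &
    forall a b c, ((a, b, c) \in B) = ((f a, f b, f c) \in B').

Definition axiomA (V : finType) (B : ternary_relation V) : Prop :=
  forall a b c, (a, b, c) \in B -> (c, b, a) \in B.

Definition axiomB (V : finType) (B : ternary_relation V) : Prop :=
  forall a b c, a != b -> b != c -> a != c ->
    [|| (a, b, c) \in B, (a, c, b) \in B, (b, a, c) \in B,
        (b, c, a) \in B, (c, a, b) \in B | (c, b, a) \in B].

Definition axiomC (V : finType) (B : ternary_relation V) : Prop :=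
  forall a b c, (a, b, c) \in B -> (a, c, b) \notin B.

Definition axiomD (V : finType) (B : ternary_relation V) : Prop :=
  forall a b c, (a, b, c) \in B -> [&& a != b, b != c & a != c].

Definition axiomF (V : finType) (B : ternary_relation V) : Prop :=
  forall a b c, (a, b, c) \in B -> ((b, c, a) \in B) || ((c, b, a) \in B).

Definition axiom2 (V : finType) (B : ternary_relation V) : Prop :=
  forall a b c x, (a, b, c) \in B -> (b, x, c) \in B -> (a, b, x) \in B.

Definition betweenness (W : finType) (d : W -> W -> nat) : ternary_relation W :=
  [set t | let: (a, b, c) := t in
    [&& a != b, b != c, a != c & d a c == d a b + d b c]].

Definition strongly_connected (T : finType) (e : rel T) : Prop :=
  forall x y, connect e x y.

(* Directed paths have pairwise distinct vertices, hence fewer than #|T| arcs;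
   the value is the dummy #|T| when y is not reachable from x. *)
Definition sp_dist (T : finType) (e : rel T) (x y : T) : nat :=
  \big[minn/#|T|]_(n < #|T| | [exists s : n.-tuple T,
    [&& path e x s, last x s == y & uniq (x :: s)]]) n.

Definition subdigraph (T : finType) (e : rel T) (S : {set T}) (f : rel T)
    : Prop :=
  forall x y, f x y -> [/\ x \in S, y \in S & e x y].

Definition arc_on (T : finType) (S : {set T}) (f : rel T)
    : rel {x : T | x \in S} :=
  fun x y => f (val x) (val y).

(* The vertex v_i is (i, false) and the vertex u_i is (i, true). *)
Definition Dpp (p : nat) : rel ('I_p * bool) :=
  fun x y => y.1 == x.1.+1 %[mod p].

Definition path_graph (n : nat) : rel 'I_n :=
  fun i j => (j == i.+1 :> nat) || (i == j.+1 :> nat).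

Definition cycle_graph (n : nat) : rel 'I_n :=
  fun i j => (j == i.+1 %[mod n]) || (i == j.+1 %[mod n]).

Arguments arc_on {T} S f.
Arguments Dpp p : clear implicits.
Arguments path_graph n : clear implicits.
Arguments cycle_graph n : clear implicits.

(* Main.v *)
Require Import Defs.
From mathcomp Require Import all_boot zify.

(** By (C) and (F) the relation meets every three-point set either in the three
    rotations of one triple (a cyclic triple) or in a triple and its reverse (a
    linear triple).  Suppose that some triple is cyclic.  Then the end points u, v
    of a linear triple uxv are twins: every third point y satisfies uyv and vyu.
    Each point has at most one twin, and one representative per twin class is
    ordered cyclically, so the class gives the index i of v_i, u_i, and d is the
    shortest-path quasimetric of the subdigraph of D_{p,p} induced by the points
    used.  If no triple is cyclic, a pair of points with the most points between
    them has all other points between them; ordering the points from one end of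
    this pair gives a path, except when two points have that end between them,
    and then these two and the pair are the four points of a 4-cycle. *)

Set Implicit Arguments.
Unset Strict Implicit.
Unset Printing Implicit Defensive.

(** * Shortest walks and ranks in finite total orders *)

Lemma leq_bigmin (I : eqType) (s : seq I) (P : pred I) (F : I -> nat) m i :
  i \in s -> P i -> \big[minn/m]_(j <- s | P j) F j <= F i.
Proof.
elim: s => // j s IH; rewrite inE big_cons => /predU1P[<- -> | /IH{}IH /IH Fi].
  exact: geq_minl.
by case: ifP => // _; rewrite (leq_trans (geq_minr _ _)).
Qed.

(** Shortening a walk of minimal length gives a simple one of the same length, which has fewer than
    [#|T|] arcs. So all walks, not only simple ones, may serve to compute [sp_dist]. *)
Lemma sp_dist_eq (T : finType) (e : rel T) x y n :
    (exists s, [/\ path e x s, last x s = y & size s = n]) ->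
    (forall s, path e x s -> last x s = y -> n <= size s) ->
  sp_dist e x y = n.
Proof.
move=> [s [es sy sn]] n_min.
subst y n; case: (shortenP es) n_min => s' es' us' sub n_min.
have s's : size s' <= size s by apply: uniq_leq_size; first by case/andP: us'.
have Ds : size s' = size s by apply/eqP; rewrite eqn_leq s's n_min.
have s'T : size s' < #|T| by have /card_uniqP /= <- := us'; apply: max_card.
apply/eqP; rewrite eqn_leq; apply/andP; split.
  rewrite -Ds; apply: (@leq_bigmin _ _ _ _ _ (Ordinal s'T)).
    by rewrite mem_index_enum.
  by apply/existsP; exists (in_tuple s'); apply/and3P.
apply: (big_ind (fun m => size s <= m)) => [|m1 m2 ? ?|i].
- by rewrite -Ds ltnW.
- by rewrite leq_min; apply/andP.
by case/existsP=> t /and3P[et /eqP ty _]; rewrite -(size_tuple t) n_min.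
Qed.

(** The rank of a point is the number of points of [A] below it. The ranks are distinct numbers
    below [#|A|], and as there are [#|A|] of them, each such number occurs. *)
Lemma order_rank (T : finType) (A : {set T}) (lt : rel T) :
    {in A, irreflexive lt} -> {in A & &, transitive lt} ->
    {in A &, forall x y, x != y -> lt x y || lt y x} ->
  exists rk : T -> nat,
    [/\ {in A, forall x, rk x < #|A|},
        {in A &, forall x y, (rk x < rk y) = lt x y},
        {in A &, injective rk} &
        forall k, k < #|A| -> exists2 x, x \in A & rk x = k].
Proof.
move=> ltxx lt_trans lt_total.
pose below x := [set z in A | lt z x].
have rk_lt x y : x \in A -> y \in A -> lt x y -> #|below x| < #|below y|.
  move=> Ax Ay xy; apply/proper_card/properP; split.
    apply/subsetP=> z; rewrite !inE => /andP[Az zx]; rewrite Az /=.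
    exact: (lt_trans x).
  by exists x; rewrite inE Ax ?ltxx ?xy.
exists (fun x => #|below x|).
have rkE : {in A &, forall x y, (#|below x| < #|below y|) = lt x y}.
  move=> x y Ax Ay; apply/idP/idP; last exact: rk_lt.
  case: (eqVneq x y) => [->|/(lt_total x y Ax Ay)/orP[//|/(rk_lt y x Ay Ax)]].
    by rewrite ltnn.
  by move=> yx /(ltn_trans yx); rewrite ltnn.
have rk_inj : {in A &, injective (fun x => #|below x|)}.
  move=> x y Ax Ay /= E; apply/eqP/negP => /negP /(lt_total x y Ax Ay).
  by rewrite -!rkE // E ltnn.
have rk_max : {in A, forall x, #|below x| < #|A|}.
  move=> x Ax; apply/proper_card/properP; split.
    by apply/subsetP=> z; rewrite inE => /andP[].
  by exists x; rewrite // inE ltxx ?andbF.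
split=> // k kA.
pose s := [seq #|below x| | x <- enum A].
have us : uniq s.
  by rewrite map_inj_in_uniq ?enum_uniq // => x y; rewrite !mem_enum; apply: rk_inj.
have sub : {subset s <= iota 0 #|A|}.
  by move=> _ /mapP[x Ax ->]; rewrite mem_iota rk_max // -mem_enum.
have sz : size (iota 0 #|A|) <= size s by rewrite size_iota size_map -cardE.
have [_ sE] := uniq_min_size us sub sz.
have : k \in s by rewrite sE mem_iota.
by case/mapP=> x; rewrite mem_enum => Ax ->; exists x.
Qed.

(** * Distances in paths and in the 4-cycle *)

(** Truncated subtraction makes the sum [|i - j|], and an edge changes the index by one. *)
Lemma path_dist n (i j : 'I_n) :
  sp_dist (path_graph n) i j = (i - j) + (j - i).
Proof.
apply: sp_dist_eq; last first.
  move=> s; elim: s i => [i _ /= ->|k s IH i /= /andP[ik ks] lj]; first by lia.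
  by have := IH _ ks lj; case/orP: ik => /eqP ->; move: (size s) => m; lia.
have [m Em] : exists m, (i - j) + (j - i) = m by exists ((i - j) + (j - i)).
rewrite Em; elim: m i Em => [|m IH] i Em.
  by exists [::]; split=> //=; apply: val_inj => /=; lia.
have [k ik Ek] : exists2 k : 'I_n, path_graph n i k & (k - j) + (j - k) = m.
  case: (ltnP i j) => ij.
    have ltn : i.+1 < n by have := ltn_ord j; lia.
    by exists (Ordinal ltn); rewrite /path_graph //=; lia.
  have ltn : i.-1 < n by have := ltn_ord i; lia.
  by exists (Ordinal ltn); rewrite /path_graph //=; lia.
have [s [ks lj ss]] := IH k Ek.
by exists (k :: s); rewrite /= ik ks lj ss.
Qed.

Lemma cycle4_dist (i j : 'I_4) :
  sp_dist (cycle_graph 4) i j =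
    if i == j then 0 else if odd (i + j) then 1 else 2.
Proof.
apply: sp_dist_eq; last first.
  move=> [|k [|l s]] /=; rewrite ?andbT; last by case: ifP => // _; case: ifP.
    by move=> _ ->; rewrite eqxx.
  move=> ik <-; case: ifP => // _; case: ifP => //.
  by case: i k ik => [[|[|[|[|i]]]] ?] [[|[|[|[|k]]]] ?].
case: (i =P j) => [->|ij]; first by exists [::].
case: ifP => par.
  exists [:: j]; rewrite /= andbT; split=> //.
  by case: i j ij par => [[|[|[|[|i]]]] ?] [[|[|[|[|k]]]] ?].
(* Distinct vertices of equal parity are opposite, and the successor of [i] is adjacent to both. *)
exists [:: inord (i.+1 %% 4); j]; rewrite /= andbT; split=> //.
rewrite /cycle_graph !inordK ?ltn_pmod //.
case: i j ij par => [[|[|[|[|i]]]] ?] [[|[|[|[|k]]]] ?] //= E _;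
  by case: E; apply: val_inj.
Qed.

(** * Distances in induced subdigraphs of [D_{p,p}] *)

(* The distance between distinct points of layers i and j; it is p if i = j. *)
Definition gap p i j := if i < j then j - i else j + p - i.

(** The two sides are congruent modulo [p] and each gap lies between 1 and [p], so they differ by 0
    or [p]. They agree if going forward from [i] through [j] to [k] takes at most one turn. *)
Lemma gap_add p i j k : i < p -> j < p -> k < p ->
  (gap p i k == gap p i j + gap p j k) =
  (i == k) && (i != j) || [|| i < j < k, j < k < i | k < i < j].
Proof.
by move=> ip jp kp; rewrite /gap; do 3![case: ltnP => ?]; lia.
Qed.

Definition induced p (S : {set 'I_p * bool}) : rel ('I_p * bool) :=
  fun x y => [&& x \in S, y \in S & Dpp p x y].

(** As [S] contains every [v_k], the walk can run through these points, possibly several times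
    round, and only its last step leads to the prescribed point [y]. *)
Lemma induced_path_exists p (S : {set 'I_p * bool}) m
    (x y : {x : 'I_p * bool | x \in S}) :
    (forall k, (k, false) \in S) ->
    (val y).1 = (val x).1 + m.+1 %[mod p] ->
  exists s, [/\ path (arc_on S (induced S)) x s, last x s = y & size s = m.+1].
Proof.
move=> layer; have p_gt0 : 0 < p by apply: leq_ltn_trans (ltn_ord (val x).1).
elim: m x => [|m IH] x Ey.
  exists [:: y]; rewrite /= andbT; split=> //.
  by rewrite /arc_on /induced (valP x) (valP y) /Dpp Ey addn1 /=.
pose k : 'I_p := Ordinal (ltn_pmod (val x).1.+1 p_gt0).
pose z : {x : 'I_p * bool | x \in S} := exist _ (k, false) (layer k).
have [s [zs ly ss]] : exists s,
    [/\ path (arc_on S (induced S)) z s, last z s = y & size s = m.+1].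
  by apply: IH; rewrite Ey /= modnDml addSnnS.
exists (z :: s); rewrite /= zs ly ss andbT; split=> //.
by rewrite /arc_on /induced (valP x) (valP z) /Dpp /= modn_mod.
Qed.

Lemma induced_path_layer p (S : {set 'I_p * bool})
    (x : {x : 'I_p * bool | x \in S}) s :
  path (arc_on S (induced S)) x s ->
  (val (last x s)).1 = (val x).1 + size s %[mod p].
Proof.
elim: s x => [|z s IH] x /=; first by rewrite addn0.
case/andP=> /and3P[_ _ /eqP xz] /IH ->.
by rewrite -modnDml xz modnDml addSnnS.
Qed.

(** The length of a walk is congruent to the difference of layers modulo [p], and [gap] is the least
    positive number with this residue. *)
Lemma induced_dist p (S : {set 'I_p * bool})
    (x y : {x : 'I_p * bool | x \in S}) :
    (forall k, (k, false) \in S) -> x != y ->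
  sp_dist (arc_on S (induced S)) x y = gap p (val x).1 (val y).1.
Proof.
move=> layer xy; set i := (val x).1; set j := (val y).1.
have [ip jp] : i < p /\ j < p by split; apply: ltn_ord.
apply: sp_dist_eq => [|s xs sy].
  have [m Em] : exists m, gap p i j = m.+1.
    by exists (gap p i j).-1; rewrite /gap; case: ltnP => ?; lia.
  rewrite Em; apply: induced_path_exists => //; rewrite -Em -/i -/j /gap.
  case: ltnP => ij; first by rewrite subnKC // ltnW.
  by rewrite subnKC ?modnDr //; lia.
have s_gt0 : 0 < size s by case: s sy xy {xs} => //= ->; rewrite eqxx.
have := induced_path_layer xs; rewrite sy -/i -/j modn_small // => Ej.
have := divn_eq (i + size s) p; rewrite -Ej.
case: (_ %/ p) => [|q] Eq; rewrite /gap; first by case: ltnP => ?; lia.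
have : p <= q.+1 * p by rewrite leq_pmull.
by case: ltnP => ?; lia.
Qed.

(** * Cyclic and linear triples *)

Section Triples.

Variables (V : finType) (B : ternary_relation V).
Hypotheses (hB : axiomB B) (hC : axiomC B) (hD : axiomD B) (hF : axiomF B).
Hypothesis h2 : axiom2 B.

Local Notation btw a b c := ((a, b, c) \in B).

Definition linear a b c : Prop := btw a b c /\ btw c b a.
Definition oriented a b c : Prop :=
  btw a b c /\ btw b c a /\ btw c a b.
Definition cyclic a b c : Prop := oriented a b c \/ oriented c b a.

Lemma btw_neq a b c : btw a b c -> [/\ a <> b, b <> c & a <> c].
Proof. by case/hD/and3P=> /eqP ? /eqP ? /eqP. Qed.

Lemma btw_swapr a b c : btw a b c -> btw a c b -> False.
Proof. by move=> /hC/negP. Qed.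

Lemma btw_cases a b c : btw a b c -> oriented a b c \/ linear a b c.
Proof.
move=> abc; case/orP: (hF abc) => [bca|]; last by right.
left; case/orP: (hF bca) => [|acb]; first by split.
by case: (btw_swapr abc acb).
Qed.

(** This is (C) for the first two places: rotating or reversing the triples by (F) moves the clash
    to the last two. *)
Lemma btw_swapl a b c : btw a b c -> btw b a c -> False.
Proof.
move=> abc; case/btw_cases: (abc) => [[_ [bca _]] bac | [_ cba] bac].
  exact: btw_swapr bca bac.
case/orP: (hF bac) => [acb | cab]; first exact: btw_swapr abc acb.
exact: btw_swapr cab cba.
Qed.

Ltac decompose_btw :=
  repeat match goal with
  | H : linear _ _ _ |- _ => destruct H
  | H : oriented _ _ _ |- _ => destruct H as [? [? ?]]
  | H : cyclic _ _ _ |- _ => destruct H as [[? [? ?]]|[? [? ?]]]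
  | H : _ /\ _ |- _ => destruct H
  | H : _ \/ _ |- _ => destruct H
  | H : [\/ _, _, _ | _] |- _ => case: H => ?
  end.

(** Closes the hypotheses under (2) and stops at a clash with (C) or its mirror form. Only triples
    of the points at hand arise, so the closure is finite. *)
Ltac saturate_btw :=
  repeat match goal with
  | H : is_true (in_mem (?a, ?b, ?c) _), K : is_true (in_mem (?a, ?c, ?b) _) |- _ =>
      destruct (btw_swapr H K)
  | H : is_true (in_mem (?a, ?b, ?c) _), K : is_true (in_mem (?b, ?a, ?c) _) |- _ =>
      destruct (btw_swapl H K)
  | H : is_true (in_mem (?a, ?b, ?c) _), K : is_true (in_mem (?b, ?x, ?c) _) |- _ =>
      lazymatch goal with
      | _ : is_true (in_mem (a, b, x) _) |- _ => fail
      | _ => pose proof (h2 H K)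
      end
  end.

Ltac btw_tac :=
  decompose_btw; saturate_btw;
  rewrite /cyclic /oriented /linear; try tauto.

Lemma triple_cases a b c : a <> b -> b <> c -> a <> c ->
  [\/ cyclic a b c, linear a b c, linear b a c | linear a c b].
Proof.
move=> /eqP ab /eqP bc /eqP ac.
case/orP: (hB ab bc ac) => [|/orP[|/orP[|/orP[|/orP[]]]]] /btw_cases;
  rewrite /cyclic /oriented /linear => -[] [];
  first [constructor 1; tauto | constructor 2; tauto | constructor 3; tauto
        | constructor 4; tauto].
Qed.

Lemma cyclicC a b c : cyclic a b c -> cyclic b a c.
Proof. rewrite /cyclic /oriented; tauto. Qed.

Lemma cyclicR a b c : cyclic a b c -> cyclic b c a.
Proof. rewrite /cyclic /oriented; tauto. Qed.

Lemma cyclicL a b c : cyclic a b c -> cyclic c a b.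
Proof. by move/cyclicR/cyclicR. Qed.

Lemma cyclicS a b c : cyclic a b c -> cyclic a c b.
Proof. by move/cyclicC/cyclicR. Qed.

Lemma cyclic_neq a b c : cyclic a b c -> [/\ a <> b, b <> c & a <> c].
Proof. by case=> -[] /btw_neq[] *; split=> // /esym. Qed.

Lemma linear_neq a b c : linear a b c -> [/\ a <> b, b <> c & a <> c].
Proof. by case=> /btw_neq. Qed.

Lemma linearC a b c : linear a b c -> linear c b a.
Proof. by case. Qed.

(** * Configurations of four and five points *)

(** Some triple on [a], [b], [c] is present. If it is [abc], then (2) with [bxc] gives [abx],
    against [axb]; the other orders are alike. *)
Lemma linear_common_middle a b c x :
  linear a x b -> linear a x c -> linear b x c -> False.
Proof.
move=> axb axc bxc.
have [_ xb ab] := linear_neq axb; have [_ xc ac] := linear_neq axc.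
have [bx _ bc] := linear_neq bxc.
by case: (triple_cases ab bc ac) => ?; btw_tac.
Qed.

Lemma linear_trans y a x z : linear y a z -> linear a x z -> linear y x z.
Proof.
move=> yaz axz; have [ya _ yz] := linear_neq yaz.
have [ax xz _] := linear_neq axz.
have xy : y <> x by move=> E; subst; btw_tac.
by case: (triple_cases xy xz yz) => ?; btw_tac.
Qed.

(** The seed of the twin property: [v] can replace [u] in a cyclic triple through [x]. All other
    shapes of the two triples clash after closure under (2). *)
Lemma cyclic_extend u x v z :
  linear u x v -> cyclic u x z -> linear u z v /\ cyclic v x z.
Proof.
move=> uxv uxz; have [ux xv uv] := linear_neq uxv.
have [_ xz uz] := cyclic_neq uxz.
have zv : z <> v by move=> E; subst; btw_tac.
case: (triple_cases uz zv uv) => ?;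
  by case: (triple_cases (nesym xv) xz (nesym zv)) => ?; btw_tac.
Qed.

(** In the last alternative [e] behaves like a twin of [d]. A linear [dce] or [dbe] leads there by
    [cyclic_extend]; the remaining linear shapes clash whatever the triple on [b], [c], [e] is. *)
Lemma cyclic_pair d b c e : cyclic d b c -> e <> d -> e <> b -> e <> c ->
  [\/ cyclic d b e, cyclic d c e | [/\ linear d b e, linear d c e & cyclic e b c]].
Proof.
move=> dbc ed eb ec; have [db bc dc] := cyclic_neq dbc.
case: (triple_cases dc (nesym ec) (nesym ed)) => dce; first by constructor 2.
  have [dbe /cyclicS ebc] := cyclic_extend dce (cyclicS dbc); by constructor 3.
all: case: (triple_cases db (nesym eb) (nesym ed)) => dbe; first by constructor 1.
all: try by have [? ?] := cyclic_extend dbe dbc; constructor 3.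
all: by case: (triple_cases (nesym eb) ec bc) => ?; btw_tac.
Qed.

Lemma cyclic_through a b c d : cyclic a b c -> exists x y, cyclic d x y.
Proof.
move=> abc.
case: (d =P a) => [->|da]; first by exists b, c.
case: (d =P b) => [->|db]; first by exists c, a; apply/cyclicR.
case: (d =P c) => [->|dc]; first by exists a, b; apply/cyclicL.
case: (cyclic_pair abc da db dc) => [abd|acd|[_ _ dbc]].
- by exists a, b; apply/cyclicL.
- by exists a, c; apply/cyclicL.
- by exists b, c.
Qed.

Lemma linear_cyclic_companion a b c u x v :
  cyclic a b c -> linear u x v -> exists z, cyclic u x z.
Proof.
move=> abc uxv; have [ux xv uv] := linear_neq uxv.
have [p [q upq]] := cyclic_through u abc.
case: (x =P p) => [->|xp]; first by exists q.
case: (x =P q) => [->|xq]; first by exists p; apply/cyclicS.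
case: (cyclic_pair upq (nesym ux) xp xq) => [upx|uqx|[upx uqx xpq]].
- by exists p; apply/cyclicS.
- by exists q; apply/cyclicS.
(* Axiom (2) gives [vxr]. Were it cyclic, [uxr] would be cyclic too, against the linear [urx]; so it
   is linear and [cyclic_extend] applies. *)
have vx r s : linear u r x -> cyclic u r s -> cyclic x r s -> linear r s v.
  move=> urx urs xrs; have [_ rx ux'] := linear_neq urx.
  have /btw_cases[?|vxr] : btw v x r by btw_tac.
    have vxr : cyclic v x r by left.
    have [_ uxr] := cyclic_extend (linearC uxv) vxr.
    by case: uxr urx => ? ?; exfalso; btw_tac.
  by have [] := cyclic_extend (linearC vxr) (cyclicC xrs).
(* Now [q] lies between [p] and [v], and [p] between [q] and [v]. *)
have bcv := vx _ _ upx upq xpq; have cbv := vx _ _ uqx (cyclicS upq) (cyclicS xpq).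
by exfalso; btw_tac.
Qed.

(** With a companion [z], both [uxz] and [vxz] are cyclic. If [y] is in a cyclic triple with one of
    [u], [v] and one of [x], [z], then [cyclic_extend] puts it between [u] and [v]. Otherwise [x]
    lies between any two of [u], [v], [y], which is impossible. *)
Lemma linear_all_middle a b c u x v y :
  cyclic a b c -> linear u x v -> y <> u -> y <> v -> linear u y v.
Proof.
move=> abc uxv yu yv.
have [z uxz] := linear_cyclic_companion abc uxv.
have [uzv vxz] := cyclic_extend uxv uxz.
case: (y =P x) => [->//|yx]; case: (y =P z) => [->//|yz].
have via w x' : linear u x' v -> cyclic w x' y -> w = u \/ w = v -> linear u y v.
  move=> ux'v wx'y [Ew|Ew]; move: wx'y; rewrite Ew => wx'y.
    by have [] := cyclic_extend ux'v wx'y.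
  by have [/linearC] := cyclic_extend (linearC ux'v) wx'y.
case: (cyclic_pair uxz yu yx yz) => [uxy|uzy|[uxy _ _]].
- by apply: (via u x) => //; left.
- by apply: (via u z) => //; left.
case: (cyclic_pair vxz yv yx yz) => [vxy|vzy|[vxy _ _]].
- by apply: (via v x) => //; right.
- by apply: (via v z) => //; right.
by case: (linear_common_middle uxv uxy vxy).
Qed.

(** * Twin classes and their representatives *)

Section Cyclic.

Variables a0 b0 c0 : V.
Hypothesis cyc0 : cyclic a0 b0 c0.

Definition twin u v := [exists x, btw u x v && btw v x u].

Lemma twinP u v y : twin u v -> y <> u -> y <> v -> linear u y v.
Proof.
case/existsP=> x /andP[uxv vxu].
exact: linear_all_middle cyc0 (conj uxv vxu).
Qed.

Lemma linear_twin u x v : linear u x v -> twin u v.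
Proof. by case=> uxv vxu; apply/existsP; exists x; rewrite uxv. Qed.

Lemma twinC u v : twin u v = twin v u.
Proof. by apply/existsP/existsP=> -[x]; rewrite andbC; exists x. Qed.

Lemma twin_neq u v : twin u v -> u <> v.
Proof. by case/existsP=> x /andP[/btw_neq[]]. Qed.

(** Two distinct twins of [u] would each lie between [u] and the other, against (C). *)
Lemma twin_uniq u v w : twin u v -> twin u w -> v = w.
Proof.
move=> uv uw; case: (v =P w) => // vw; exfalso.
have := twinP uv (nesym (twin_neq uw)) (nesym vw).
have := twinP uw (nesym (twin_neq uv)) vw.
by move=> [uvw _] [uwv _]; apply: btw_swapr uvw uwv.
Qed.

Definition sim u v := (u == v) || twin u v.
(** Twins define the same predicate [sim], so [pick] gives them the same point. *)
Definition rep v := odflt v [pick w | sim v w].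

Lemma sim_trans u v w : sim u v -> sim v w -> sim u w.
Proof.
case/predU1P=> [->//|uv] /predU1P[<-|vw]; first by rewrite /sim uv orbT.
by rewrite /sim (@twin_uniq v u w) ?eqxx // twinC.
Qed.

Lemma simC u v : sim u v = sim v u.
Proof. by rewrite /sim eq_sym twinC. Qed.

Lemma sim_rep v : sim v (rep v).
Proof.
by rewrite /rep; case: pickP => [//|/(_ v)]; rewrite /sim eqxx.
Qed.

Lemma rep_eq u v : (rep u == rep v) = sim u v.
Proof.
apply/eqP/idP=> [E|uv].
  by apply: (@sim_trans _ (rep u)); [|rewrite E simC]; apply: sim_rep.
rewrite /rep (@eq_pick _ _ (sim v)); last first.
  move=> w; apply/idP/idP; apply: sim_trans => //; by rewrite simC.
by case: pickP => // /(_ v); rewrite /sim eqxx.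
Qed.

Lemma rep_idem v : rep (rep v) = rep v.
Proof. by apply/eqP; rewrite rep_eq simC sim_rep. Qed.

Lemma rep_twin u v : u <> v -> rep u = rep v -> twin u v.
Proof. by move=> /eqP/negPf uv /eqP; rewrite rep_eq /sim uv. Qed.

Lemma btw_rot a b c : rep a <> rep c -> btw a b c -> btw b c a.
Proof.
move=> ac /btw_cases[[_ []//]|/linear_twin ac'].
by case: ac; apply/eqP; rewrite rep_eq /sim ac' orbT.
Qed.

(** For twins [a], [a'] the triple [a'ba] holds, and (2) with the rotation [bca] gives [a'bc]. *)
Lemma btw_subst a a' b c :
    rep a <> rep b -> rep b <> rep c -> rep a <> rep c -> rep a = rep a' ->
  btw a b c -> btw a' b c.
Proof.
move=> ab bc ac aa' abc; case: (a =P a') => [<-//|/rep_twin/(_ aa') tw].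
have [ba ba'] : b <> a /\ b <> a' by split=> E; apply: ab; rewrite ?aa' E.
have [_ a'ba] := twinP tw ba ba'.
exact: h2 a'ba (btw_rot ac abc).
Qed.

(** Rotation brings each point to the front once, where [btw_subst] replaces it. *)
Lemma btw_rep_impl a b c a' b' c' :
    rep a <> rep b -> rep b <> rep c -> rep a <> rep c ->
    rep a = rep a' -> rep b = rep b' -> rep c = rep c' ->
  btw a b c -> btw a' b' c'.
Proof.
move=> ab bc ac aa' bb' cc' abc.
have a'bc := btw_subst ab bc ac aa' abc; rewrite aa' in ab ac.
have bca' := btw_rot ac a'bc.
have b'ca' := btw_subst bc (nesym ac) (nesym ab) bb' bca'; rewrite bb' in ab bc.
have ca'b' := btw_rot (nesym ab) b'ca'.
have c'a'b' := btw_subst (nesym ac) ab (nesym bc) cc' ca'b'; rewrite cc' in bc.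
exact: btw_rot (nesym bc) c'a'b'.
Qed.

Lemma btw_rep a b c :
    rep a <> rep b -> rep b <> rep c -> rep a <> rep c ->
  btw a b c = btw (rep a) (rep b) (rep c).
Proof.
by move=> ab bc ac; apply/idP/idP; apply: btw_rep_impl; rewrite ?rep_idem.
Qed.

(** * The cyclic order of the representatives *)

Definition reps := [set v | rep v == v].

Lemma rep_reps v : rep v \in reps.
Proof. by rewrite inE rep_idem. Qed.

Lemma reps_neq u v : u \in reps -> v \in reps -> u <> v -> rep u <> rep v.
Proof. by rewrite !inE => /eqP-> /eqP->. Qed.

Lemma reps_rot a b c : a \in reps -> c \in reps -> btw a b c -> btw b c a.
Proof.
move=> Ra Rc abc; have [_ _ ac] := btw_neq abc.
by apply: btw_rot abc; apply: reps_neq.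
Qed.

Lemma reps_cyclic a b c : a \in reps -> b \in reps -> c \in reps ->
  a <> b -> b <> c -> a <> c -> cyclic a b c.
Proof.
move=> Ra Rb Rc ab bc ac.
by case: (triple_cases ab bc ac) => // /linear_twin tw; exfalso;
  [move: (reps_neq Ra Rc ac)|move: (reps_neq Rb Rc bc)|move: (reps_neq Ra Rb ab)];
  apply; apply/eqP; rewrite rep_eq /sim tw orbT.
Qed.

(* The cyclic order of the representatives, cut open before the one of a0. *)
Definition after u v := let r := rep a0 in (u == r) && (v != r) || btw r u v.

Lemma after_irreflexive : irreflexive after.
Proof.
move=> x; rewrite /after andbN /=; by apply/negP=> /btw_neq[_].
Qed.

Lemma after_neq u v : after u v -> v <> rep a0.
Proof. by case/orP=> [/andP[_ /eqP]|/btw_neq[_ _ /nesym]]. Qed.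

Lemma after_root v : after (rep a0) v = (v != rep a0).
Proof.
rewrite /after eqxx /=; case: eqP => //= _.
by apply/negP=> /btw_neq[].
Qed.

Lemma afterE u v : u <> rep a0 -> after u v = btw (rep a0) u v.
Proof. by rewrite /after => /eqP/negPf->. Qed.

Lemma after_trans : {in reps & &, transitive after}.
Proof.
move=> y x w Ry Rx Rw xy yw; have yr := after_neq xy; have wr := after_neq yw.
case: (x =P rep a0) => [->|xr]; first by rewrite after_root; apply/eqP.
move: xy yw; rewrite !afterE // => rxy ryw; have Rr := rep_reps a0.
(* With [r] the root, [wry] and [rxy] give [wrx] by (2); the rest is rotation. *)
by apply: reps_rot => //; apply: h2 rxy; do 2!apply: reps_rot => //.
Qed.

Lemma after_total : {in reps &, forall x y, x != y -> after x y || after y x}.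
Proof.
move=> x y Rx Ry /eqP xy.
case: (x =P rep a0) => [E|xr].
  by rewrite E after_root -E; case: eqP => // /nesym.
case: (y =P rep a0) => [E|yr].
  by rewrite E after_root -E orbC; case: eqP.
rewrite !afterE //.
by case: (reps_cyclic (rep_reps a0) Rx Ry (nesym xr) xy (nesym yr))
  => [[->//]|[_ [_ ->]]]; rewrite orbT.
Qed.

(** With [r] the root, rotation gives [abr] and [bcr], and (2) gives [abc]. *)
Lemma after_btw a b c : a \in reps -> b \in reps -> c \in reps ->
  after a b -> after b c -> btw a b c.
Proof.
move=> Ra Rb Rc ab bc; have br := after_neq ab; have Rr := rep_reps a0.
move: bc; rewrite afterE // => rbc.
case: (a =P rep a0) => [->//|ar]; move: ab; rewrite afterE // => rab.
by apply: h2 (reps_rot Rr Rb rab) _; apply: reps_rot rbc.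
Qed.

(** * The isomorphism onto a subdigraph of [D_{p,p}] *)

Lemma layered_isomorphic :
  exists (p : nat) (S : {set 'I_p * bool}),
    [/\ 1 <= p <= #|V|, strongly_connected (arc_on S (induced S)) &
        isomorphic B (betweenness (sp_dist (arc_on S (induced S))))].
Proof.
have [||| rk [rk_max rkE rk_inj rk_surj]] := @order_rank V reps after.
- by move=> x _; apply: after_irreflexive.
- exact: after_trans.
- exact: after_total.
have rk_lt v : rk (rep v) < #|reps| by rewrite rk_max ?rep_reps.
(* The representative of the class of rank [i] becomes [v_i], and its twin, if any, [u_i]; so [p] is
   the number of classes. *)
pose f v : 'I_#|reps| * bool := (Ordinal (rk_lt v), v != rep v).
pose S := [set f v | v in [set: V]].
have layer k : (k, false) \in S.
  have [v Rv vk] := rk_surj k (ltn_ord k).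
  apply/imsetP; exists v; first by rewrite inE.
  have /eqP rv : rep v == v by rewrite inE in Rv.
  by congr (_, _); rewrite ?rv ?eqxx //; apply: val_inj; rewrite /= rv.
have rk_rep u v : rk (rep u) = rk (rep v) -> rep u = rep v.
  by apply: rk_inj; apply: rep_reps.
have f_inj : injective f.
  move=> u v [/rk_rep uv]; rewrite -uv => Enuv.
  case: (u =P v) => // nuv.
  move: Enuv; case: (u =P rep u) => Eu; case: (v =P rep u) => Ev //= _.
    by rewrite Ev.
  by apply: (@twin_uniq (rep u)); apply: rep_twin; rewrite ?rep_idem //; exact/nesym.
pose g v : {x | x \in S} := exist _ (f v) (imset_f f (in_setT v)).
have g_inj : injective g by move=> u v /(congr1 val) /f_inj.
have conn : strongly_connected (arc_on S (induced S)).
  move=> x y; case: (x =P y) => [->|_]; first exact: connect0.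
  have [m Em] : exists m, (val y).1 = (val x).1 + m.+1 %[mod #|reps|].
    have := ltn_ord (val x).1; set i := nat_of_ord _ => ip.
    (* The difference of layers plus [p], which is positive as [i < p]; the predecessor fits the
       form [m.+1]. *)
    exists ((val y).1 + (#|reps| - i)).-1.
    rewrite prednK; last by lia.
    by rewrite addnCA subnKC ?modnDr // ltnW.
  have [s [xs ys _]] := induced_path_exists layer Em.
  by apply/connectP; exists s.
exists #|reps|, S; split=> //.
  by rewrite max_card andbT (leq_trans _ (rk_lt a0)).
exists g.
  apply: inj_card_bij => //; rewrite card_sig.
  have cardS : #|S| <= #|V| by rewrite card_imset // cardsT.
  by apply: leq_trans cardS; apply/subset_leq_card/subsetP.
move=> a b c; rewrite inE !(inj_eq g_inj).
case: (a =P b) => [->|ab]; first by apply/negP=> /btw_neq[].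
case: (b =P c) => [->|bc]; first by apply/negP=> /btw_neq[].
case: (a =P c) => [->|ac]; first by apply/negP=> /btw_neq[].
rewrite !induced_dist ?(inj_eq g_inj); try exact/eqP; try by [].
rewrite /=.
rewrite gap_add ?rk_lt //.
have rk_eq u v : (rk (rep u) == rk (rep v)) = (rep u == rep v).
  by apply/eqP/eqP=> [/rk_rep|->].
(* For twins [a], [c] both sides hold: the way from [a] through [b] to [c] is one full turn, of
   length [p]. *)
case: (rep a =P rep c) => [rac|rac].
  have [-> _] := twinP (rep_twin ac rac) (nesym ab) bc.
  rewrite -rac eqxx rk_eq; case: (rep a =P rep b) => // rab; case: bc.
  by apply: (@twin_uniq a); apply: rep_twin.
have -> : (rk (rep a) == rk (rep c)) = false by rewrite rk_eq; apply/eqP.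
(* For twins [a], [b] both sides fail: [acb] excludes [abc], and the distance [p] from [a] to [b] is
   at least that from [a] to [c]. Twins [b], [c] are alike. *)
case: (rep a =P rep b) => [rab|rab].
  have [acb _] := twinP (rep_twin ab rab) (nesym ac) (nesym bc).
  rewrite -rab; transitivity false; last by lia.
  by apply/negP=> /btw_swapr/(_ acb).
case: (rep b =P rep c) => [rbc|rbc].
  have [bac _] := twinP (rep_twin bc rbc) ab ac.
  rewrite -rbc; transitivity false; last by lia.
  by apply/negP=> /btw_swapl/(_ bac).
rewrite btw_rep //=.
have Ra := rep_reps a; have Rb := rep_reps b; have Rc := rep_reps c.
move: rab rbc rac Ra Rb Rc.
move: (rep a) (rep b) (rep c) => x y z xy yz xz Rx Ry Rz.
have rk_neq u v : u \in reps -> v \in reps -> u <> v -> rk u <> rk v.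
  by move=> Ru Rv uv /rk_inj E; apply/uv/E.
have nxy := rk_neq _ _ Rx Ry xy; have nyz := rk_neq _ _ Ry Rz yz.
have nxz := rk_neq _ _ Rx Rz xz.
have cyc u v w : u \in reps -> v \in reps -> w \in reps ->
    rk u < rk v < rk w -> oriented u v w.
  move=> Ru Rv Rw /andP[uv vw].
  have uvw : btw u v w by apply: after_btw; rewrite -?rkE.
  have vwu := reps_rot Ru Rw uvw.
  by split=> //; split=> //; apply: reps_rot Rv Ru vwu.
apply/idP/or3P=> [xyz|]; last by case=> /cyc[] // ? [].
(* Three distinct ranks not in the cyclic order of [x], [y], [z] are in the reverse one, whose
   triples clash with [xyz]. *)
have not_rev :
    [|| rk z < rk y < rk x, rk y < rk x < rk z | rk x < rk z < rk y] -> False.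
  case/or3P=> /cyc[] // t1 [t2 t3].
  - exact: btw_swapr xyz t3.
  - exact: btw_swapr xyz t2.
  - exact: btw_swapr xyz t1.
have : [|| rk x < rk y < rk z, rk y < rk z < rk x | rk z < rk x < rk y].
  by apply/negP=> ?; apply: not_rev; lia.
by move/or3P.
Qed.

End Cyclic.

(** * Symmetric relations: extreme points and the linear order *)

Section Symmetric.

Hypothesis hA : axiomA B.

Ltac btw_sym_tac :=
  decompose_btw; saturate_btw;
  repeat (match goal with
  | H : is_true (in_mem (?a, ?b, ?c) _) |- _ =>
      lazymatch goal with
      | _ : is_true (in_mem (c, b, a) _) |- _ => fail
      | _ => pose proof (hA H)
      end
  end; saturate_btw).

Lemma btw_linear a b c : btw a b c -> linear a b c.
Proof. by move=> abc; split; [|apply: hA]. Qed.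

Lemma middle_cases a b c : a <> b -> b <> c -> a <> c ->
  [\/ linear a b c, linear b a c | linear a c b].
Proof.
move=> ab bc ac; case: (triple_cases ab bc ac) => abc.
- by case: abc => -[/btw_linear ? ?]; exfalso; btw_tac.
- by constructor 1.
- by constructor 2.
- by constructor 3.
Qed.

Lemma extreme_points (a0 z0 : V) : a0 != z0 ->
  exists a z, a <> z /\ forall y, y <> a -> y <> z -> linear a y z.
Proof.
move=> neq0; pose between (q : V * V) := [set x | btw q.1 x q.2].
(* All that lies between [a] and [z] lies between [y] and [z], and so does [a]. Hence a pair with
   the most points between has no point beyond its ends. *)
have grow y a z : linear y a z -> #|between (a, z)| < #|between (y, z)|.
  move=> yaz; apply/proper_card/properP; split; last first.
    by exists a; rewrite !inE /=; [case: yaz | apply/negP => /btw_neq[]].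
  apply/subsetP=> x; rewrite !inE /= => /btw_linear axz.
  by have [] := linear_trans yaz axz.
have betweenC a z : #|between (a, z)| = #|between (z, a)|.
  by apply: eq_card => x; rewrite !inE; apply/idP/idP; apply: hA.
pose P (q : V * V) := q.1 != q.2.
case: (@arg_maxnP _ (a0, z0) P (fun q => #|between q|) neq0).
move=> -[a z] /= /eqP /= az maxq; exists a, z; split=> // y ya yz.
have max_az p q : p <> q -> #|between (p, q)| <= #|between (a, z)|.
  by move/eqP=> pq; apply: maxq.
case: (middle_cases (nesym ya) yz az) => // [/grow yaz|/linearC/grow].
  by have := max_az _ _ yz; rewrite leqNgt yaz.
by rewrite betweenC => yza; have := max_az _ _ ya; rewrite leqNgt yza.
Qed.

(** Otherwise one of [x], [y] lies between [z] and the other, which clashes with [axz], [ayz] and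
    [xay] under (2) and (A). *)
Lemma opposite_far a z x y : a <> z ->
    (forall w, w <> a -> w <> z -> linear a w z) -> linear x a y ->
  linear x z y.
Proof.
move=> az all_az xay; have [xa ay xy] := linear_neq xay.
have yz : y <> z.
  by move=> E; subst; have := all_az x xa xy => axz; btw_tac.
have xz : x <> z.
  by move=> E; subst; have := all_az y (nesym ay) yz => ayz; btw_tac.
have ayz := all_az y (nesym ay) yz; have axz := all_az x xa xz.
by case: (middle_cases xz (nesym yz) xy) => ? //; exfalso; btw_sym_tac.
Qed.

(** A fifth point [e] would lie between [a] and [z], and by [opposite_far] whenever [a] is between
    [e] and some point, so is [z]. With this every arrangement of [e] clashes. *)
Lemma opposite_exhaust a z x y e : a <> z ->
    (forall w, w <> a -> w <> z -> linear a w z) -> linear x a y ->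
  [\/ e = a, e = x, e = z | e = y].
Proof.
move=> az all_az xay.
case: (e =P a) => [?|ea]; first by constructor 1.
case: (e =P x) => [?|ex]; first by constructor 2.
case: (e =P z) => [?|ez]; first by constructor 3.
case: (e =P y) => [?|ey]; first by constructor 4.
exfalso.
have xzy := opposite_far az all_az xay; have [xa ay xy] := linear_neq xay.
have [xz zy _] := linear_neq xzy.
have aez := all_az e ea ez; have axz := all_az x xa xz.
have ayz := all_az y (nesym ay) (nesym zy).
have far w : linear e a w -> linear e z w by exact: opposite_far.
case: (middle_cases (nesym ea) ex (nesym xa)) => axe;
  case: (middle_cases (nesym ea) ey ay) => aye;
  try have exz := far _ axe; try have eyz := far _ aye;
  case: (middle_cases (nesym ex) ey xy) => xey; btw_sym_tac.
all: case: (middle_cases ex xz ez) => ?; btw_sym_tac.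
all: case: (middle_cases ey (nesym zy) ez) => ?; btw_sym_tac.
Qed.

Definition linear_order_of (lt : rel V) : Prop :=
  [/\ irreflexive lt, transitive lt, (forall x y, x != y -> lt x y || lt y x) &
      forall x y z, lt x y -> lt y z -> linear x y z].

Lemma linear_order_exists :
  (exists lt, linear_order_of lt) \/
  exists a x z y, [/\ uniq [:: a; x; z; y],
    forall e, e \in [:: a; x; z; y], linear a x z /\ linear x z y &
    linear z y a /\ linear y a x].
Proof.
case: (boolP [exists q : V * V, q.1 != q.2]); last first.
  (* With at most one point the empty relation is the order. *)
  move/existsPn=> all_eq; left; exists (fun _ _ => false); split=> // x y xy.
  by have := all_eq (x, y); rewrite negbK /= (negPf xy).
case/existsP=> -[a0 z0] /extreme_points[a [z [az all_az]]].
case: (boolP [exists q : V * V, btw q.1 a q.2]) => [/existsP[[x y] /=]|no_opp].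
  move/btw_linear=> xay; right; exists a, x, z, y.
  have xzy := opposite_far az all_az xay.
  have [xa ay xy] := linear_neq xay; have [xz zy _] := linear_neq xzy.
  split.
  - rewrite /= !inE !negb_or !andbT; apply/and3P; split;
      by rewrite ?andbT; do ?[apply/andP; split]; apply/eqP => // /esym.
  - move=> e; rewrite !inE; case: (opposite_exhaust e az all_az xay) => ->;
      by rewrite eqxx ?orbT.
  - by split=> //; apply: all_az.
  - by split; apply: linearC => //; apply: all_az => // /esym.
left; have no_opp' x y : btw x a y -> False.
  by move=> xay; case/existsP: no_opp; exists (x, y).
(* The order as seen from the end [a]. It is total because [a] lies between no two points. *)
exists (fun x y => (y != x) && (x == a) || btw a x y); split.
- by move=> x; rewrite eqxx /=; apply/negP=> /btw_neq[_].
- move=> y x w; case: (x =P a) => [->|xa].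
    move=> _; rewrite andbT; case: (y =P a) => [->|ya].
      by rewrite andbT => ->.
    by rewrite andbF /= => /btw_neq[_ _ /eqP]; rewrite eq_sym => ->.
  rewrite !andbF /= => axy; case: (y =P a) => [E|ya].
    by move: axy; rewrite E => /btw_neq[].
  rewrite andbF /= => ayw.
  have /linearC := btw_linear axy; have /linearC := btw_linear ayw => wya yxa.
  by have [] := linear_trans wya yxa.
- move=> x y xy; case: (x =P a) => [<-|/eqP xa]; first by rewrite eq_sym xy.
  case: (y =P a) => [E|/eqP ya]; first by rewrite -E xy orbT.
  rewrite !andbF /=; move/eqP: xy => xy; move/eqP: xa => xa; move/eqP: ya => ya.
  case: (middle_cases (nesym xa) xy (nesym ya)) => [[->]|[/no_opp']|[->]] //.
  by rewrite orbT.
- move=> x y w; case: (x =P a) => [->|xa].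
    rewrite andbT => /orP[ya|/btw_neq[]//].
    by rewrite (negPf ya) andbF => /btw_linear.
  rewrite andbF /= => axy; have [_ _ /nesym/eqP/negPf ya] := btw_neq axy.
  by rewrite ya andbF /= => ayw; apply/linearC/btw_linear/(h2 (hA ayw))/hA.
Qed.

(** * Isomorphisms with the path and the 4-cycle *)

Lemma path_isomorphic lt : linear_order_of lt ->
  isomorphic B (betweenness (sp_dist (path_graph #|V|))).
Proof.
case=> lt_irr lt_trans lt_total lt_linear.
have [||| rk [rk_max rkE rk_inj _]] := @order_rank V [set: V] lt.
- by move=> x _; apply: lt_irr.
- by move=> x y z _ _ _; apply: lt_trans.
- by move=> x y _ _; apply: lt_total.
have rk_lt x : rk x < #|V| by rewrite -cardsT rk_max ?inE.
pose f x : 'I_#|V| := Ordinal (rk_lt x).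
have f_inj : injective f by move=> x y [] /rk_inj; apply; rewrite inE.
exists f; first by apply: inj_card_bij; rewrite ?card_ord.
have ltE x y : lt x y = (rk x < rk y) by rewrite rkE ?inE.
move=> a b c; rewrite inE !(inj_eq f_inj) !path_dist /=.
apply/idP/and4P=> [abc|[ab bc ac /eqP d_abc]]; last first.
  suff : linear a b c by case.
  have rk_neq x y : x != y -> rk x <> rk y.
    by move=> /eqP xy /rk_inj E; apply/xy/E; rewrite inE.
  have := rk_neq _ _ ab; have := rk_neq _ _ bc => ? ?.
  case: (ltnP (rk a) (rk c)) => ?.
    by apply: lt_linear; rewrite ltE; lia.
  by apply/linearC/lt_linear; rewrite ltE; lia.
have [/eqP ab /eqP bc /eqP ac] := btw_neq abc; split=> //; move/btw_linear: abc => abc.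
(* If [a], [b], [c] were not monotone in [lt], another point than [b] would be the middle one, and
   its linear triple would clash with [abc]. *)
case/orP: (lt_total _ _ ab) => l1; case/orP: (lt_total _ _ bc) => l2;
  case/orP: (lt_total _ _ ac) => l3;
  solve [by move: l1 l2 l3; rewrite !ltE; lia
        | exfalso; match goal with
          | H : is_true (lt ?x ?y), K : is_true (lt ?y ?z) |- _ =>
              pose proof (lt_linear _ _ _ H K); solve [btw_tac]
          end].
Qed.

(** The list [a, x, z, y] runs round the cycle. The four linear triples settle the four three-point
    sets, and every other triple clashes with them or has equal entries. *)
Lemma cycle4_isomorphic a x z y :
    uniq [:: a; x; z; y] -> (forall e, e \in [:: a; x; z; y]) ->
    linear a x z -> linear x z y -> linear z y a -> linear y a x ->
  isomorphic B (betweenness (sp_dist (cycle_graph 4))).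
Proof.
move=> us s_all axz xzy zya yax.
have idx_lt e : index e [:: a; x; z; y] < 4.
  by rewrite -[4]/(size [:: a; x; z; y]) index_mem.
pose f e : 'I_4 := Ordinal (idx_lt e).
have f_inj : injective f by move=> u v /(congr1 val) /(index_inj a (s_all u) (s_all v)).
have card4 : #|V| = 4.
  have /card_uniqP /= <- := us; apply: eq_card => e; rewrite !inE.
  by have := s_all e; rewrite !inE => ->.
exists f; first by apply: inj_card_bij; rewrite ?card_ord ?card4.
have [[ax xz _] [_ zy xy] [_ ya za]] :=
  And3 (linear_neq axz) (linear_neq xzy) (linear_neq zya).
have neqE (p q : V) : p <> q -> ((p == q) = false) * ((q == p) = false).
  by move/eqP/negPf=> pq; rewrite [q == p]eq_sym.
have eqs := (eqxx, neqE _ _ ax, neqE _ _ xz, neqE _ _ zy, neqE _ _ xy,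
  neqE _ _ ya, neqE _ _ za).
move=> u v w; rewrite inE !(inj_eq f_inj) !cycle4_dist !(inj_eq f_inj) /=.
have := s_all u; have := s_all v; have := s_all w; rewrite !inE.
case/or4P=> /eqP->; case/or4P=> /eqP->; case/or4P=> /eqP->; rewrite !eqs /=;
  solve [ by case: axz | by case: xzy | by case: zya | by case: yax
        | apply/negbTE/negP => t; have [] := btw_neq t; btw_tac].
Qed.

End Symmetric.

End Triples.

Theorem theorem2 (V : finType) (B : ternary_relation V)
    (hB : axiomB B) (hC : axiomC B) (hD : axiomD B) (hF : axiomF B)
    (h2 : axiom2 B) :
  (~ axiomA B ->
     exists (p : nat) (S : {set 'I_p * bool}) (E : rel ('I_p * bool)),
       [/\ 1 <= p <= #|V|,
           subdigraph (Dpp p) S E,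
           strongly_connected (arc_on S E) &
           isomorphic B (betweenness (sp_dist (arc_on S E)))]) /\
  (axiomA B ->
     isomorphic B (betweenness (sp_dist (path_graph #|V|))) \/
     isomorphic B (betweenness (sp_dist (cycle_graph 4)))).
Proof.
split=> [notA | hA]; last first.
  have [[lt lt_order]|[a [x [z [y [us s_all [axz xzy] [zya yax]]]]]]] :=
    linear_order_exists hB hC hD hF h2 hA.
  - by left; apply: path_isomorphic lt_order.
  - by right; apply: cycle4_isomorphic us s_all axz xzy zya yax.
(* A triple without its reverse is cyclic by (F); the search for one is decidable, so the failure of
   (A) yields a witness. *)
have [a [b [c abc]]] : exists a b c, cyclic B a b c.
  case: (boolP [exists t : V * V * V,
      (t \in B) && ((t.2, t.1.2, t.1.1) \notin B)]) => [|no_asym].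
    case/existsP=> -[[a b] c] /= /andP[abc /negP cba]; exists a, b, c; left.
    by case: (btw_cases hC hF abc) => // -[_ /cba].
  case: notA => a b c abc; apply/negPn/negP=> cba; case/negP: no_asym.
  by apply/existsP; exists (a, b, c); rewrite abc.
have [p [S [pV conn iso]]] := layered_isomorphic hB hC hD hF h2 abc.
by exists p, S, (induced S); split=> // x y /and3P.
Qed.
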